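(* Let $V$ be a finite universal ground set with $|V|=n$, let $f:2^V\to\mathbb{R}_{\ge 0}$ be a (possibly non-monotone) submodular function, and let $k\in\mathbb{N}$. Suppose that for every $\tau>0$ there exists a $\tau$-thresholding dynamic algorithm (for $f$ and cardinality bound $k$) that makes an expected (amortized) $O(g(n,k))$ oracle queries per update. Then, for every $\varepsilon>0$, there exist the following dynamic algorithms, which at every time $t$ maintain a set $S_t\subseteq V_t$ with $|S_t|\le k$: (i) a dynamic algorithm with approximation guarantee $8+\varepsilon$ (i.e., $\mathbb{E}[f(S_t)]\ge \mathrm{OPT}^*_t/(8+\varepsilon)$ at every time $t$) using an expected (amortized) $O\big(k+\min(k,g(n,k))\cdot g(n,k)\cdot \varepsilon^{-1}\log k\big)$ oracle queries per update; (ii) a dynamic algorithm with approximation guarantee $10+\varepsilon$ (i.e., $\mathbb{E}[f(S_t)]\ge \mathrm{OPT}^*_t/(10+\varepsilon)$ at every time $t$) using an expected (amortized) $O\big(\min(k,g(n,k))\cdot g(n,k)\cdot\varepsilon^{-1}\log k\big)$ oracle queries per update.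
   Context: Submodularity: $f(A)+f(B)\ge f(A\cup B)+f(A\cap B)$ for all $A,B\subseteq V$. Marginal gain: $\Delta(e\mid A)=f(A\cup\{e\})-f(A)$. Dynamic model: there is a sequence $\Xi$ of updates, each inserting an element of $V$ into or deleting an element from the current ground set; time $t$ is the $t$-th update and $V_t\subseteq V$ is the set of elements inserted but not deleted after their last insertion up to time $t$. $\mathrm{OPT}^*_t=\max_{S\subseteq V_t,|S|\le k} f(S)$. Access to $f$ is via an oracle returning $f(A)$ for any queried $A\subseteq V$; the cost (query complexity) of an algorithm is the number of oracle queries it makes. The adversary is oblivious: the entire update sequence is fixed in advance, independently of the algorithm's random bits. A dynamic algorithm is called $\tau$-thresholding (for a parameter $\tau>0$) if at every time $t$ it reports a set $S_t\subseteq V_t$ with $|S_t|\le k$ such that: (Property 1) either (a) $|S_t|=k$ and $f(S_t)\ge k\tau$, or (b) $|S_t|<k$ and $\Delta(v\mid S_t)<\tau$ for every $v\in V_t\setminus S_t$; and (Property 2) the number of elements changed in any update, $|S_{t+1}\setminus S_t|+|S_t\setminus S_{t+1}|$, is at most the number of oracle queries the algorithm makes during that update. *)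

(* Defs.v *)
From mathcomp Require Import all_boot all_order all_algebra.
From mathcomp Require Import interval_inference reals exp.

Set Implicit Arguments.
Unset Strict Implicit.
Unset Printing Implicit Defensive.

Import Order.TTheory GRing.Theory Num.Theory.
Local Open Scope ring_scope.

Section SetFunctions.
Variables (R : realType) (V : finType).
Implicit Types (f : {set V} -> R) (A B : {set V}).

Definition nonneg f := forall A, 0 <= f A.

Definition submodular f :=
  forall A B, f (A :|: B) + f (A :&: B) <= f A + f B.

Definition marginal f (e : V) A : R := f (e |: A) - f A.

(* The default 0 of the iterated maximum is harmless for nonnegative f, since
   set0 is always in the range. *)
Definition opt f (k : nat) (W : {set V}) : R :=
  \big[Num.max/0]_(S : {set V} | (S \subset W) && (#|S| <= k)%N) f S.

End SetFunctions.

(* An update is a pair: (true, e) inserts e and (false, e) deletes e.  No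
   restriction is put on the updates: an element may be inserted when already
   present, or deleted when absent. *)
Definition update (V : finType) : Type := (bool * V)%type.
Definition ins (V : finType) (e : V) : update V := (true, e).
Definition del (V : finType) (e : V) : update V := (false, e).

(* Xi i is the (i+1)-st update, so that the ground set at time t depends on
   Xi 0, ..., Xi (t-1).  An element is present iff some insertion of it (hence
   the last one) is not followed by a deletion. *)
Definition ground (V : finType) (Xi : nat -> update V) (t : nat) : {set V} :=
  [set e | [exists i : 'I_t, (Xi i == ins e) &&
             [forall j : 'I_t, (i < j)%N ==> (Xi j != del e)]]].

Lemma ground0 (V : finType) (Xi : nat -> update V) : ground Xi 0 = set0.
Proof. by apply/setP => e; rewrite !inE; apply/existsP => -[[]]. Qed.

Lemma groundS (V : finType) (Xi : nat -> update V) (t : nat) :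
  ground Xi t.+1 = let: (b, e) := Xi t in
                   if b then e |: ground Xi t else ground Xi t :\ e.
Proof.
have E e : e \in ground Xi t.+1 =
    (Xi t == ins e) || ((Xi t != del e) && (e \in ground Xi t)).
  rewrite !inE; apply/existsP/orP.
    case=> -[i lti] /andP[/= /eqP Xi_i /forallP nodel].
    have := lti; rewrite ltnS leq_eqVlt => /orP[/eqP eit|ltit].
      by left; rewrite -eit Xi_i.
    right; apply/andP; split; first by have /implyP/(_ ltit) := nodel ord_max.
    apply/existsP; exists (Ordinal ltit); rewrite /= Xi_i eqxx /=.
    apply/forallP => j; apply/implyP => ltij.
    by have /implyP/(_ ltij) := nodel (widen_ord (leqnSn t) j).
  case=> [Xi_t|/andP[Xi_t /existsP[i /andP[Xi_i /forallP nodel]]]].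
    exists ord_max; rewrite /= Xi_t /=; apply/forallP => j; apply/implyP.
    by rewrite ltnNge -ltnS ltn_ord.
  exists (widen_ord (leqnSn t) i); rewrite /= Xi_i /=; apply/forallP => -[j ltj].
  apply/implyP => /= ltij; move: ltj; rewrite ltnS leq_eqVlt => /orP[/eqP->//|lj].
  by have /implyP/(_ ltij) := nodel (Ordinal lj).
apply/setP => e; rewrite E; case: (Xi t) => -[] x; rewrite !inE /ins /del !xpair_eqE /=.
  by rewrite eq_sym.
by rewrite eq_sym.
Qed.

(* Randomized programs with oracle access to a set function: the only way for
   a program to obtain information on f is the Query node, whose continuation
   receives f A.  Flip p tosses a fresh p-biased coin.  All other computation
   is free. *)
Inductive prog (R : realType) (V : finType) (T : Type) : Type :=
| Ret of T
| Query of {set V} & (R -> prog R V T)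
| Flip of {i01 R} & (bool -> prog R V T).
Arguments Ret {R V T}.
Arguments Query {R V T}.
Arguments Flip {R V T}.

Section Programs.
Variables (R : realType) (V : finType).

Fixpoint bind (T U : Type) (p : prog R V T) (h : T -> prog R V U) : prog R V U :=
  match p with
  | Ret a => h a
  | Query A c => Query A (fun y => bind (c y) h)
  | Flip b c => Flip b (fun x => bind (c x) h)
  end.

(* Expectation of h (result) (number of oracle queries), with oracle f. *)
Fixpoint expect (T : Type) (f : {set V} -> R) (p : prog R V T)
    (h : T -> nat -> R) : R :=
  match p with
  | Ret a => h a 0%N
  | Query A c => expect f (c (f A)) (fun a q => h a q.+1)
  | Flip b c => b%:num * expect f (c true) h
                + (1 - b%:num) * expect f (c false) h
  end.

(* P (result) (number of oracle queries) holds with probability 1. *)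
Fixpoint always (T : Type) (f : {set V} -> R) (p : prog R V T)
    (P : T -> nat -> Prop) : Prop :=
  match p with
  | Ret a => P a 0%N
  | Query A c => always f (c (f A)) (fun a q => P a q.+1)
  | Flip b c => (0 < b%:num -> always f (c true) P) /\
                (b%:num < 1 -> always f (c false) P)
  end.

End Programs.

(* A dynamic algorithm keeps an arbitrary internal state, from which the
   reported set is read off; the algorithm sees the updates one at a time, and
   it depends neither on f nor on future updates. *)
Record dynalg (R : realType) (V : finType) := DynAlg {
  state : Type;
  init : state;
  step : state -> update V -> prog R V state;
  out : state -> {set V}
}.

Section DynamicAlgorithms.
Variables (R : realType) (V : finType).
Implicit Types (f : {set V} -> R) (k : nat) (D : dynalg R V).

(* The first t updates; the query count is the total over these updates.  The
   stream Xi is fixed before any coin is tossed (oblivious adversary). *)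
Fixpoint run D (Xi : nat -> update V) (t : nat) : prog R V (state D) :=
  if t is t'.+1 then bind (run D Xi t') (fun s => step s (Xi t'))
  else Ret (init D).

Definition maintains f k D : Prop :=
  forall Xi t, always f (run D Xi t) (fun s _ =>
    (out s \subset ground Xi t) /\ (#|out s| <= k)%N).

Definition threshold_property f k (tau : R) (W S : {set V}) : Prop :=
  (#|S| = k /\ k%:R * tau <= f S) \/
  ((#|S| < k)%N /\ forall v, v \in W :\: S -> marginal f v S < tau).

Definition thresholding f k (tau : R) D : Prop :=
  [/\ maintains f k D,
      forall Xi t, always f (run D Xi t) (fun s _ =>
        threshold_property f k tau (ground Xi t) (out s)) &
      forall Xi t, always f (run D Xi t) (fun s _ =>
        always f (step s (Xi t)) (fun s' q =>
          (#|out s' :\: out s| + #|out s :\: out s'| <= q)%N))].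

(* At most b oracle queries per update, in expectation and amortized over the
   first T updates, for every T. *)
Definition amortized_queries f D (b : R) : Prop :=
  forall Xi (T : nat), expect f (run D Xi T) (fun _ q => q%:R) <= T%:R * b.

Definition approximates f k (alpha : R) D : Prop :=
  forall Xi t,
    opt f k (ground Xi t) / alpha <= expect f (run D Xi t) (fun s _ => f (out s)).

End DynamicAlgorithms.

(* The logarithm occurring in asymptotic bounds; it equals ln k for k >= 3, and
   avoids the degenerate bound 0 at k = 1. *)
Definition logk (R : realType) (k : nat) : R := Num.max 1 (ln k%:R).

(* Main.v *)
(* For a threshold tau, run a tau-thresholding algorithm on the current elements
   and a second one on the elements that the first leaves out, with outputs S1
   and S2.  If both are smaller than k, no remaining element has marginal gain
   above tau, and submodularity gives, for an optimal set O,
     f O <= f S1 + f S2 + f (O :&: S1) + 2 k tau.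
   A uniformly random subset B of S1 satisfies 4 E f(B) >= f (O :&: S1).  Taking
   tau just above b / k, where b is the best value queried so far, bounds this by
   (6 + 2 r) times the expected value of the best set seen after querying B, with
   r the ratio of the geometric sequence of thresholds.  An element e is sent
   only to the O(log k / eps) thresholds between f {e} / k and f {e}.
   The second algorithm sees at most 1 + min(2k, q) updates when the first
   makes q queries; as it does not share coins with the first, its amortized
   bound still applies to this random update sequence. *)

Require Import Defs.
From mathcomp Require Import all_boot all_order all_algebra.
From mathcomp Require Import interval_inference reals exp.
From mathcomp Require Import boolp sequences.
From mathcomp Require Import zify ring lra.
Set Implicit Arguments.
Unset Strict Implicit.
Unset Printing Implicit Defensive.
Import Order.TTheory GRing.Theory Num.Theory.
Local Open Scope ring_scope.

(** * Expectation, support and expected cost of randomized programs *)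

Section ProgramCalculus.
Variables (R : realType) (V : finType).
Implicit Types (f : {set V} -> R) (S T U : Type).

Definition mean f T (p : prog R V T) (h : T -> R) := expect f p (fun a _ => h a).
Definition cost f T (p : prog R V T) := expect f p (fun _ q => q%:R).

(** Results and query counts reached with positive probability. This is the relational form of
    [always]; it lets almost sure facts be used under an expectation, through [le_expect]. *)
Fixpoint supp f T (p : prog R V T) (a : T) (q : nat) : Prop :=
  match p with
  | Ret b => a = b /\ q = 0%N
  | Query A c => exists2 q', q = q'.+1 & supp f (c (f A)) a q'
  | Flip b c => (0 < b%:num /\ supp f (c true) a q) \/
                (b%:num < 1 /\ supp f (c false) a q)
  end.

Lemma bindA T U S (p : prog R V T) (k : T -> prog R V U) (h : U -> prog R V S) :
  bind (bind p k) h = bind p (fun a => bind (k a) h).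
Proof.
elim: p => [a|A c IH|b c IH] //=.
  by congr (Query _ _); apply: funext => y; exact: IH.
by congr (Flip _ _); apply: funext => y; exact: IH.
Qed.

Lemma bind_ret T (p : prog R V T) : bind p (fun a => Ret a) = p.
Proof.
elim: p => [a|A c IH|b c IH] //=.
  by congr (Query _ _); apply: funext => y; exact: IH.
by congr (Flip _ _); apply: funext => y; exact: IH.
Qed.

Lemma eq_expect f T (p : prog R V T) h1 h2 :
  (forall a q, h1 a q = h2 a q) -> expect f p h1 = expect f p h2.
Proof.
elim: p h1 h2 => [a|A c IH|b c IH] h1 h2 E //=; first by apply: IH => *; apply: E.
by rewrite !(IH _ _ _ E).
Qed.

Lemma eq_mean f T (p : prog R V T) h1 h2 :
  (forall a, h1 a = h2 a) -> mean f p h1 = mean f p h2.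
Proof. by move=> E; apply: eq_expect => a _. Qed.

Lemma expect_bind f T U (p : prog R V T) (k : T -> prog R V U) h :
  expect f (bind p k) h =
  expect f p (fun a q => expect f (k a) (fun b q' => h b (q + q')%N)).
Proof.
by elim: p h => [a|A c IH|b c IH] h //=; rewrite !IH.
Qed.

Lemma expectD f T (p : prog R V T) h1 h2 :
  expect f p (fun a q => h1 a q + h2 a q) = expect f p h1 + expect f p h2.
Proof. by elim: p h1 h2 => [a|A c IH|b c IH] h1 h2 //=; rewrite !IH; ring. Qed.

Lemma expectZ f T (p : prog R V T) r h :
  expect f p (fun a q => r * h a q) = r * expect f p h.
Proof. by elim: p h => [a|A c IH|b c IH] h //=; rewrite !IH; ring. Qed.

Lemma expect_cst f T (p : prog R V T) r : expect f p (fun _ _ => r) = r.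
Proof. by elim: p => [a|A c IH|b c IH] //=; rewrite !IH; ring. Qed.

Lemma le_expect f T (p : prog R V T) h1 h2 :
  (forall a q, supp f p a q -> h1 a q <= h2 a q) ->
  expect f p h1 <= expect f p h2.
Proof.
elim: p h1 h2 => [a|A c IH|b c IH] h1 h2 /= le12; first exact: le12.
  by apply: IH => a q s; apply: le12; exists q.
have b0 : 0 <= b%:num by [].
have b1 : b%:num <= 1 :> R by [].
apply: lerD.
  move: b0; rewrite le_eqVlt => /orP[/eqP<-|b0]; first by rewrite !mul0r.
  by rewrite ler_pM2l //; apply: IH => a q s; apply: le12; left.
move: b1; rewrite le_eqVlt => /orP[/eqP->|b1]; first by rewrite subrr !mul0r.
by rewrite ler_pM2l ?subr_gt0 //; apply: IH => a q s; apply: le12; right.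
Qed.

Lemma alwaysP f T (p : prog R V T) P :
  always f p P <-> forall a q, supp f p a q -> P a q.
Proof.
elim: p P => [a|A c IH|b c IH] P /=.
- by split=> [Pa _ _ [-> ->]//|]; apply.
- split=> [/IH H a _ [q -> s]|H]; first exact: H s.
  by apply/IH => a q s; apply: H; exists q.
- split=> [[Ht Hf] a q [[b0 s]|[b1 s]]|H].
  + by move/IH: (Ht b0); apply.
  + by move/IH: (Hf b1); apply.
  + by split=> ?; apply/IH => a q s; apply: H; [left|right].
Qed.

Lemma supp_bind f T U (p : prog R V T) (k : T -> prog R V U) b q :
  supp f (bind p k) b q ->
  exists a q1 q2, [/\ supp f p a q1, supp f (k a) b q2 & q = (q1 + q2)%N].
Proof.
elim: p q => [a|A c IH|r c IH] q /=.
- by move=> s; exists a, 0%N, q.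
- move=> [q' -> /IH [a [q1 [q2 [s1 s2 ->]]]]].
  by exists a, q1.+1, q2; split=> //; exists q1.
- by move=> [[r0 /IH]|[r1 /IH]] [a [q1 [q2 [s1 s2 ->]]]];
    exists a, q1, q2; split=> //; [left|right].
Qed.

Lemma bind_supp f T U (p : prog R V T) (k : T -> prog R V U) a b q1 q2 :
  supp f p a q1 -> supp f (k a) b q2 -> supp f (bind p k) b (q1 + q2)%N.
Proof.
elim: p q1 => [a'|A c IH|r c IH] q1 /=.
- by move=> [-> ->].
- by move=> [q' -> s] s2; exists (q' + q2)%N => //; exact: IH s s2.
- by move=> [[r0 s]|[r1 s]] s2; [left|right]; split=> //; exact: IH s s2.
Qed.

Lemma mean_bind f T U (p : prog R V T) (k : T -> prog R V U) h :
  mean f (bind p k) h = mean f p (fun a => mean f (k a) h).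
Proof. exact: expect_bind. Qed.

Lemma meanD f T (p : prog R V T) h1 h2 :
  mean f p (fun a => h1 a + h2 a) = mean f p h1 + mean f p h2.
Proof. exact: expectD. Qed.

Lemma meanZ f T (p : prog R V T) r h :
  mean f p (fun a => r * h a) = r * mean f p h.
Proof. exact: expectZ. Qed.

Lemma mean_cst f T (p : prog R V T) r : mean f p (fun _ => r) = r.
Proof. exact: expect_cst. Qed.

Lemma mean_sum f T (p : prog R V T) I (s : seq I) (h : I -> T -> R) :
  mean f p (fun a => \sum_(i <- s) h i a) = \sum_(i <- s) mean f p (h i).
Proof.
elim: s => [|i s IH].
  by rewrite big_nil -[RHS](mean_cst f p); apply: eq_mean => a; rewrite big_nil.
rewrite big_cons -IH -meanD; apply: eq_mean => a; by rewrite big_cons.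
Qed.

Lemma le_mean f T (p : prog R V T) h1 h2 :
  (forall a q, supp f p a q -> h1 a <= h2 a) -> mean f p h1 <= mean f p h2.
Proof. exact: le_expect. Qed.

Lemma mean_ge f T (p : prog R V T) h r :
  (forall a q, supp f p a q -> r <= h a) -> r <= mean f p h.
Proof. by move=> H; rewrite -[leLHS](mean_cst f p); apply: le_mean. Qed.

(** Neither program depends on the result of the other, so their coins are independent and the order
    of averaging is free. *)
Lemma exchange_mean f T U (p : prog R V T) (p' : prog R V U) h :
  mean f p (fun a => mean f p' (h a)) =
  mean f p' (fun b => mean f p (fun a => h a b)).
Proof.
rewrite /mean; elim: p h => [a|A c IH|r c IH] h //=.
rewrite !IH -!expectZ -expectD; exact: eq_expect.
Qed.

Lemma cost_bind f T U (p : prog R V T) (k : T -> prog R V U) :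
  cost f (bind p k) = cost f p + mean f p (fun a => cost f (k a)).
Proof.
rewrite /cost expect_bind /mean -expectD; apply: eq_expect => a q.
rewrite -[q%:R in RHS](expect_cst f (k a)) -expectD.
by apply: eq_expect => b q'; rewrite natrD.
Qed.

Lemma cost_query f T A (c : R -> prog R V T) :
  cost f (Query A c) = 1 + cost f (c (f A)).
Proof.
rewrite /cost /= -[X in _ = X + _](expect_cst f (c (f A))) -expectD.
by apply: eq_expect => b q'; rewrite -natr1 addrC.
Qed.

End ProgramCalculus.

(** * Runs on finite update sequences *)

Section Feeding.
Variables (R : realType) (V : finType).
Implicit Types (f : {set V} -> R) (D : dynalg R V) (l : seq (update V)).

Fixpoint feed D (s : state D) l : prog R V (state D) :=
  if l is u :: l' then bind (step s u) (fun s' => feed s' l') else Ret s.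

Lemma feed_cat D (s : state D) l1 l2 :
  feed s (l1 ++ l2) = bind (feed s l1) (fun s' => feed s' l2).
Proof.
elim: l1 s => [|u l IH] s //=.
by rewrite bindA; congr (bind _ _); apply: funext => s'; exact: IH.
Qed.

Lemma feed_rcons D (s : state D) l u :
  feed s (rcons l u) = bind (feed s l) (fun s' => step s' u).
Proof.
rewrite -cats1 feed_cat; congr (bind _ _); apply: funext => s' /=.
exact: bind_ret.
Qed.

Lemma run_feed D Xi t : run D Xi t = feed (init D) (mkseq Xi t).
Proof.
by elim: t => [//|t IH]; rewrite mkseqS feed_rcons -IH.
Qed.

Definition update_ground (W : {set V}) (u : update V) :=
  if u.1 then u.2 |: W else W :\ u.2.

Definition ground_of l := foldl update_ground set0 l.

Lemma ground_of_rcons l u : ground_of (rcons l u) = update_ground (ground_of l) u.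
Proof. by rewrite /ground_of -cats1 foldl_cat. Qed.

Lemma ground_mkseq (Xi : nat -> update V) t : ground Xi t = ground_of (mkseq Xi t).
Proof.
elim: t => [|t IH]; first exact: ground0.
by rewrite groundS IH mkseqS ground_of_rcons /update_ground; case: (Xi t).
Qed.

Lemma ground_of_filter (P : pred V) l :
  ground_of [seq u <- l | P u.2] = [set e in ground_of l | P e].
Proof.
elim/last_ind: l => [|l u IH]; first by apply/setP => e; rewrite !inE.
rewrite filter_rcons !ground_of_rcons; case: ifP => Pu.
  rewrite ground_of_rcons IH; apply/setP => e; rewrite /update_ground.
  case: ifP; rewrite !inE; last by rewrite andbA.
  by case: eqP => [->|]; rewrite ?Pu.
rewrite IH; apply/setP => e; rewrite /update_ground.
by case: ifP; rewrite !inE; case: eqP => [->|]; rewrite ?Pu ?andbF.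
Qed.

(* The stream extending a finite sequence needs a default update u0, which
   does not exist when V is empty. *)
Lemma ground_nth (u0 : update V) l : ground (nth u0 l) (size l) = ground_of l.
Proof. by rewrite ground_mkseq mkseq_nth. Qed.

Lemma run_nth D (u0 : update V) l : run D (nth u0 l) (size l) = feed (init D) l.
Proof. by rewrite run_feed mkseq_nth. Qed.

Lemma amortized_feed f D b (u0 : update V) l :
  amortized_queries f D b -> cost f (feed (init D) l) <= (size l)%:R * b.
Proof. by move=> H; rewrite -(run_nth _ u0); exact: H. Qed.

End Feeding.

(** * Random subsets and submodular inequalities *)

Section Submodular.
Variables (R : realType) (V : finType).
Implicit Types (f : {set V} -> R) (s : seq V) (A B S W : {set V}).

Let half_ge0 : 0 <= 2^-1 :> R. Proof. by rewrite invr_ge0. Qed.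
Let half_le1 : 2^-1 <= 1 :> R. Proof. by rewrite invf_le1 ?ler1n. Qed.

Fixpoint random_subset s : prog R V {set V} :=
  if s is x :: s' then
    Flip (Itv01 half_ge0 half_le1) (fun c => bind (random_subset s') (fun B =>
      Ret (if c then x |: B else B)))
  else Ret set0.

Lemma mean_random_subset_cons g f x s :
  mean f (random_subset (x :: s)) g =
  (mean f (random_subset s) (fun B => g (x |: B)) + mean f (random_subset s) g) / 2.
Proof.
rewrite {1}/mean /= -!/(mean _ _ _) !mean_bind /mean /=.
have -> : (1 - 2^-1 : R) = 2^-1 by field.
ring.
Qed.

Lemma supp_random_subset f s B q :
  supp f (random_subset s) B q -> B \subset [set x in s] /\ q = 0%N.
Proof.
elim: s B q => [|x s IH] B q /=; first by move=> [-> ->]; rewrite sub0set.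
case=> -[_ H]; have [B' [q1 [q2 [/IH [sB' ->] [-> ->] ->]]]] := supp_bind H;
  split=> //; apply/subsetP => y yB.
  have := subsetP sB' y; move: yB; rewrite !inE => /orP[->//|yB /(_ yB) ->].
  by rewrite orbT.
by have := subsetP sB' y yB; rewrite !inE orbC => ->.
Qed.

Lemma cost_random_subset f s : cost f (random_subset s) = 0.
Proof.
rewrite -[RHS](expect_cst f (random_subset s)); apply/eqP; rewrite eq_le.
by apply/andP; split; apply: le_expect => a q /supp_random_subset [_ ->].
Qed.

Lemma submodular_setU1 f x : submodular f -> submodular (fun A => f (x |: A)).
Proof.
move=> sf A B; have := sf (x |: A) (x |: B).
by rewrite -setUUr -setUIr.
Qed.

(** Induction on [s], with [x] in [A] by symmetry. The induction hypothesis is applied to [f] and to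
    [f] shifted by [x], and two uses of submodularity compare the average of the two bounds with the
    claim. The oracle [g] is kept apart from the averaged function [f], as only the latter is
    shifted. *)
Lemma sampling_partition (g : {set V} -> R) f s A B :
  uniq s -> submodular f -> A :|: B = [set x in s] -> [disjoint A & B] ->
  f set0 + f A + f B + f (A :|: B) <= 4 * mean g (random_subset s) f.
Proof.
elim: s f A B => [|x s IH] f A B /=.
  move=> _ sf AB _.
  have [A0 B0] : A = set0 /\ B = set0.
    by split; apply/setP => y; move/setP/(_ y): AB; rewrite !inE;
      case: (y \in A); case: (y \in B).
  by rewrite A0 B0 setU0 /mean /=; lra.
move=> /andP[xs us] sf.
wlog xA : A B / x \in A.
  move=> W AB dAB; case: (boolP (x \in A)) => xA; first exact: W.
  have xB : x \in B by move/setP/(_ x): AB; rewrite !inE eqxx (negbTE xA).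
  have := W B A xB; rewrite setUC disjoint_sym => /(_ AB dAB).
  lra.
move=> AB dAB; rewrite mean_random_subset_cons.
have xB : x \notin B by rewrite (disjointFr dAB xA).
have AB' : (A :\ x) :|: B = [set y in s].
  apply/setP => y; move/setP/(_ y): AB; rewrite !inE.
  case: eqVneq => [->|] //=; by rewrite (negbTE xB) (negbTE xs).
have dAB' : [disjoint A :\ x & B] by apply: disjointWl dAB; apply: subsetDl.
have H1 := IH f _ _ us sf AB' dAB'.
have H2 := IH _ _ _ us (submodular_setU1 x sf) AB' dAB'.
rewrite /= setU0 in H2.
have E1 : x |: (A :\ x) = A by rewrite setD1K.
have E2 : x |: (A :\ x :|: B) = A :|: B by rewrite setUA E1.
rewrite E1 E2 in H2.
have S1 := sf (A :\ x) [set x].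
rewrite setUC E1 in S1.
have I1 : (A :\ x) :&: [set x] = set0.
  by apply/setP => y; rewrite !inE; case: eqP; rewrite ?andbF.
rewrite I1 in S1.
have S2 := sf (A :\ x :|: B) (x |: B).
have U2 : (A :\ x :|: B) :|: (x |: B) = A :|: B.
  apply/setP => y; rewrite !inE; case: eqVneq => [->|_] /=; first by rewrite xA orbT.
  by case: (y \in A); case: (y \in B).
have I2 : (A :\ x :|: B) :&: (x |: B) = B.
  apply/setP => y; rewrite !inE; case: eqVneq => [->|] /=; first by rewrite (negbTE xB).
  by case: (y \in A); case: (y \in B).
rewrite U2 I2 in S2.
lra.
Qed.

(** The partition of [S] into [T] and [S :\: T], with the other three values dropped by
    nonnegativity. *)
Lemma sampling (g : {set V} -> R) f S (T : {set V}) :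
  nonneg f -> submodular f -> T \subset S ->
  f T <= 4 * mean g (random_subset (enum S)) f.
Proof.
move=> nf sf TS.
have E : T :|: (S :\: T) = [set x in enum S].
  apply/setP => x; rewrite !inE mem_enum; case: (boolP (x \in T)) => //=.
  by move=> /(subsetP TS) ->.
have D : [disjoint T & S :\: T].
  by rewrite -setI_eq0; apply/eqP/setP => x; rewrite !inE; case: (x \in T).
have := sampling_partition g (enum_uniq S) sf E D.
by have := nf set0; have := nf (S :\: T); have := nf (T :|: (S :\: T)); lra.
Qed.

Lemma submodular_marginal f e A B :
  submodular f -> A \subset B -> e \notin B -> marginal f e B <= marginal f e A.
Proof.
move=> sf AB eB; have := sf (e |: A) B; rewrite /marginal.
have -> : e |: A :|: B = e |: B by rewrite -setUA (setUidPr AB).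
have -> : (e |: A) :&: B = A.
  apply/setP => x; rewrite !inE; case: eqVneq => [->|] /=.
    by rewrite (negbTE eB); apply/esym/negbTE; apply: contra eB; apply/subsetP.
  by move=> _; apply: andb_idr; apply/subsetP.
lra.
Qed.

(** The elements of [A] are added to [S] one at a time; by submodularity each gain is at most the
    gain over [S] itself. *)
Lemma marginal_sum f S A r :
  submodular f -> 0 <= r -> (forall e, e \in A :\: S -> marginal f e S <= r) ->
  f (S :|: A) <= f S + #|A|%:R * r.
Proof.
move=> sf r0; move: {2}#|A| (erefl #|A|) => n; elim: n A => [|n IH] A.
  by move=> /eqP; rewrite cards_eq0 => /eqP-> _; rewrite setU0 cards0 mul0r addr0.
move=> cA H.
have /card_gt0P [e eA] : (0 < #|A|)%N by rewrite cA.
have cA' : #|A :\ e| = n by move: cA; rewrite (cardsD1 e) eA => -[].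
have H' : f (S :|: A :\ e) <= f S + #|A :\ e|%:R * r.
  by apply: IH => // x; rewrite !inE => /and3P[xS _ xA]; apply: H; rewrite inE xS.
rewrite cA' in H'; rewrite cA -natr1 mulrDl mul1r addrA.
have E : S :|: A = e |: (S :|: A :\ e).
  by rewrite setUCA setD1K.
case: (boolP (e \in S)) => eS.
  have -> : S :|: A = S :|: A :\ e.
    by rewrite E; apply/setUidPr; rewrite sub1set inE eS.
  lra.
have := submodular_marginal (e := e) sf (subsetUl S (A :\ e)).
rewrite !inE eqxx (negbTE eS) /= => /(_ isT).
have := H e; rewrite !inE eS eA => /(_ isT).
rewrite {2}/marginal -E; lra.
Qed.

Lemma opt_le f k W r :
  0 <= r -> (forall A, A \subset W -> (#|A| <= k)%N -> f A <= r) -> opt f k W <= r.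
Proof. by move=> r0 H; apply: bigmax_le => // A /andP[]; exact: H. Qed.

(** Since [S1] and [S2] are disjoint, [S1 :|: O] and [S2 :|: O :\: S1] meet exactly in [O :\: S1].
    Submodularity thus bounds [f (O :\: S1)] by the values of these two unions, which [marginal_sum]
    controls; a second use of it splits [O] along [S1]. *)
Lemma two_thresholds f (O S1 S2 : {set V}) k (r : R) :
  nonneg f -> submodular f -> 0 <= r -> (#|O| <= k)%N -> [disjoint S1 & S2] ->
  (forall e, e \in O :\: S1 -> marginal f e S1 <= r) ->
  (forall e, e \in O :\: S1 -> e \notin S2 -> marginal f e S2 <= r) ->
  f O <= f S1 + f S2 + f (O :&: S1) + 2 * k%:R * r.
Proof.
move=> nf sf r0 cO d12 H1 H2.
have B1 : f (S1 :|: O) <= f S1 + #|O|%:R * r by apply: marginal_sum.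
have B2 : f (S2 :|: O :\: S1) <= f S2 + #|O :\: S1|%:R * r.
  apply: marginal_sum => // e; rewrite !inE => /and3P[e2 e1 eO].
  by apply: H2 => //; rewrite inE e1.
have B3 := sf (S1 :|: O) (S2 :|: O :\: S1).
have I3 : (S1 :|: O) :&: (S2 :|: O :\: S1) = O :\: S1.
  apply/setP => x; rewrite !inE.
  have := disjointFr d12 (x := x); case: (x \in S1) => /= [->//|_].
  by case: (x \in O); case: (x \in S2).
rewrite I3 in B3.
have B4 := sf (O :&: S1) (O :\: S1).
rewrite setID in B4.
have N0 := nf (O :&: S1 :&: (O :\: S1)).
have N1 := nf (S1 :|: O :|: (S2 :|: O :\: S1)).
have c1 : #|O|%:R * r <= k%:R * r by apply: ler_wpM2r => //; rewrite ler_nat.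
have c2 : #|O :\: S1|%:R * r <= k%:R * r.
  apply: ler_wpM2r => //; rewrite ler_nat; apply: leq_trans cO.
  exact/subset_leq_card/subsetDl.
lra.
Qed.

(** Serves the degenerate cases, in which the empty set is already optimal. *)
Lemma le_set0_of_marginal f A :
  submodular f -> (forall e, e \in A -> f [set e] <= f set0) -> f A <= f set0.
Proof.
move=> sf H; have := @marginal_sum f set0 A 0 sf (lexx _).
rewrite set0U mulr0 addr0; apply=> e.
by rewrite !inE => /= eA; rewrite /marginal setU0 subr_le0 H.
Qed.

End Submodular.

(** * The thresholding guarantees along finite sequences *)

Section Thresholding.
Variables (R : realType) (V : finType) (f : {set V} -> R) (k : nat) (tau : R).
Variables (A : dynalg R V) (u0 : update V).
Hypothesis thrA : thresholding f k tau A.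

Lemma thresholding_feed l s q : supp f (feed (init A) l) s q ->
  [/\ out s \subset ground_of l, (#|out s| <= k)%N &
      threshold_property f k tau (ground_of l) (out s)].
Proof.
case: thrA => M Th _ H; rewrite -(run_nth _ u0) in H.
have /alwaysP/(_ _ _ H) := M (nth u0 l) (size l).
have /alwaysP/(_ _ _ H) := Th (nth u0 l) (size l).
by rewrite ground_nth => ? [].
Qed.

Lemma thresholding_change l s q u s' q' :
  supp f (feed (init A) l) s q -> supp f (step s u) s' q' ->
  (#|out s' :\: out s| + #|out s :\: out s'| <= q')%N.
Proof.
case: thrA => _ _ C H H'; have /alwaysP := C (nth u0 (rcons l u)) (size l).
rewrite run_feed.
have E : mkseq (nth u0 (rcons l u)) (size l) = l.
  apply: (@eq_from_nth _ u0); first by rewrite size_mkseq.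
  by move=> i; rewrite size_mkseq => il; rewrite nth_mkseq // nth_rcons il.
rewrite E => /(_ _ _ H) /alwaysP; rewrite nth_rcons ltnn eqxx; exact.
Qed.

End Thresholding.

(** * Updates leading from one ground set to another *)

Section DiffUpdates.
Variables (V : finType).
Implicit Types (W S : {set V}) (u : update V).

Definition diff_updates W W' : seq (update V) :=
  [seq del x | x <- enum (W :\: W')] ++ [seq ins x | x <- enum (W' :\: W)].

Lemma size_diff_updates W W' :
  size (diff_updates W W') = (#|W :\: W'| + #|W' :\: W|)%N.
Proof. by rewrite size_cat !size_map -!cardE. Qed.

Lemma foldl_diff_updates W W' :
  foldl (@update_ground V) W (diff_updates W W') = W'.
Proof.
have Del (s : seq V) X : foldl (@update_ground V) X [seq del x | x <- s] = X :\: [set x in s].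
  elim: s X => [|x s IH] X /=; first by apply/setP => y; rewrite !inE.
  rewrite IH; apply/setP => y; rewrite /update_ground !inE /= negb_or.
  by case: (y == x); case: (y \in s); case: (y \in X).
have Ins (s : seq V) X : foldl (@update_ground V) X [seq ins x | x <- s] = X :|: [set x in s].
  elim: s X => [|x s IH] X /=; first by apply/setP => y; rewrite !inE orbF.
  rewrite IH; apply/setP => y; rewrite /update_ground !inE /=.
  by case: (y == x); case: (y \in s); case: (y \in X).
rewrite foldl_cat Del Ins; apply/setP => y; rewrite !inE !mem_enum !inE.
by case: (y \in W); case: (y \in W').
Qed.

Lemma ground_of_diff_updates l W :
  ground_of (l ++ diff_updates (ground_of l) W) = W.
Proof. by rewrite /ground_of foldl_cat foldl_diff_updates. Qed.

Lemma card_diff_update_ground W u :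
  (#|W :\: update_ground W u| + #|update_ground W u :\: W| <= 1)%N.
Proof.
rewrite /update_ground; case: ifP => _.
  have -> : W :\: (u.2 |: W) = set0.
    by apply/setP => y; rewrite !inE; case: (y \in W); rewrite ?orbT ?andbF.
  rewrite cards0 add0n -(cards1 u.2); apply/subset_leq_card/subsetP => y.
  by rewrite !inE; case: (y \in W); rewrite ?orbF.
have -> : (W :\ u.2) :\: W = set0.
  by apply/setP => y; rewrite !inE; case: (y \in W); rewrite ?andbF.
rewrite cards0 addn0 -(cards1 u.2); apply/subset_leq_card/subsetP => y.
by rewrite !inE; case: (y \in W); rewrite ?andbT ?negbK ?andbF.
Qed.

Lemma card_diff_setD W S W' S' :
  (#|(W :\: S) :\: (W' :\: S')| + #|(W' :\: S') :\: (W :\: S)| <=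
   (#|W :\: W'| + #|W' :\: W|) + (#|S' :\: S| + #|S :\: S'|))%N.
Proof.
have L X T X' T' : (#|(X :\: T) :\: (X' :\: T')| <= #|X :\: X'| + #|T' :\: T :> {set V}|)%N.
  apply: leq_trans (leq_card_setU _ _); apply/subset_leq_card/subsetP => y.
  by rewrite !inE; case: (y \in X); case: (y \in X'); case: (y \in T); case: (y \in T').
by have := L W S W' S'; have := L W' S' W S; lia.
Qed.

End DiffUpdates.

(** * Two chained copies of a thresholding algorithm *)

Section Pair.
Variables (R : realType) (V : finType) (A : dynalg R V).

(* The second copy of A runs on the elements not selected by the first; log2
   is the update sequence fed to it, which depends on the coins of the first
   copy only. *)
Record pair_state := PairState {
  first : state A; log1 : seq (update V);
  second : state A; log2 : seq (update V) }.

(** The updates that bring the second copy from its present ground set to what the first copy leaves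
    out after [u]; both ground sets are recomputed from the logs. *)
Definition feedback l1 l2 (u : update V) (s1 : state A) :=
  diff_updates (ground_of l2) (ground_of (rcons l1 u) :\: out s1).

Definition pair_step (st : pair_state) (u : update V) : prog R V pair_state :=
  bind (step (first st) u) (fun s1 =>
    bind (feed (second st) (feedback (log1 st) (log2 st) u s1)) (fun s2 =>
      Ret (PairState s1 (rcons (log1 st) u) s2 (log2 st ++ feedback (log1 st) (log2 st) u s1)))).

Definition pair := DynAlg (PairState (init A) [::] (init A) [::]) pair_step
  (fun st => out (first st)).

Variable f : {set V} -> R.
Implicit Types (l : seq (update V)) (st : pair_state).

Lemma supp_pair_step st u st' q : supp f (pair_step st u) st' q ->
  [/\ exists2 q1, supp f (step (first st) u) (first st') q1 &
        (q1 <= q)%N,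
      exists q2, supp f (feed (second st) (feedback (log1 st) (log2 st) u (first st'))) (second st') q2,
      log1 st' = rcons (log1 st) u &
      log2 st' = log2 st ++ feedback (log1 st) (log2 st) u (first st')].
Proof.
move=> H; have [s1 [q1 [q2 [H1 H2 ->]]]] := supp_bind H.
have [s2 [q3 [q4 [H3 [-> ->] ->]]]] := supp_bind H2.
by split=> //=; [exists q1 => //; exact: leq_addr | exists q3].
Qed.

Lemma supp_pair l st q : supp f (feed (init pair) l) st q ->
  [/\ log1 st = l,
      exists q1, supp f (feed (init A) l) (first st) q1,
      exists q2, supp f (feed (init A) (log2 st)) (second st) q2 &
      ground_of (log2 st) = ground_of l :\: out (first st)].
Proof.
elim/last_ind: l st q => [|l u IH] st q.
  move=> [-> _] /=; split=> //; [by exists 0%N..|].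
  by apply/setP => y; rewrite !inE andbF.
rewrite feed_rcons => H.
have [st0 [q1 [q2 [/IH [E1 [q3 H3] [q4 H4] E2]]]]] := supp_bind H.
move=> /supp_pair_step [[q5 H5 _] [q6 H6] E3 E4] _; split.
- by rewrite E3 E1.
- by exists (q3 + q5)%N; rewrite feed_rcons; exact: bind_supp H3 H5.
- by exists (q4 + q6)%N; rewrite E4 feed_cat; exact: bind_supp H4 H6.
- by rewrite E4 ground_of_diff_updates E1.
Qed.

Lemma mean_pair_step st u (phi : pair_state -> R) : mean f (pair_step st u) phi =
  mean f (step (first st) u) (fun s1 =>
    mean f (feed (second st) (feedback (log1 st) (log2 st) u s1)) (fun s2 =>
      phi (PairState s1 (rcons (log1 st) u) s2 (log2 st ++ feedback (log1 st) (log2 st) u s1)))).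
Proof.
by rewrite mean_bind; apply: eq_mean => s1; rewrite mean_bind.
Qed.

Lemma cost_pair_step st u : cost f (pair_step st u) =
  cost f (step (first st) u) +
  mean f (step (first st) u) (fun s1 => cost f (feed (second st) (feedback (log1 st) (log2 st) u s1))).
Proof.
rewrite cost_bind; congr (_ + _); apply: eq_mean => s1.
rewrite cost_bind [X in _ + X](_ : _ = 0) ?addr0 //.
by rewrite -[RHS](mean_cst f (feed (second st) (feedback (log1 st) (log2 st) u s1))).
Qed.

Lemma mean_pair_first l (phi : state A -> R) :
  mean f (feed (init pair) l) (fun st => phi (first st)) = mean f (feed (init A) l) phi.
Proof.
elim/last_ind: l phi => [//|l u IH] phi.
rewrite !feed_rcons !mean_bind -IH; apply: eq_mean => st.
by rewrite mean_pair_step; apply: eq_mean => s1; rewrite /= mean_cst.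
Qed.

(* Independence of the two copies: conditionally on its log, the second one is
   distributed as a fresh run. *)
Lemma mean_pair_resample l (phi : pair_state -> R) :
  mean f (feed (init pair) l) phi =
  mean f (feed (init pair) l) (fun st =>
    mean f (feed (init A) (log2 st)) (fun s2 =>
      phi (PairState (first st) (log1 st) s2 (log2 st)))).
Proof.
elim/last_ind: l phi => [//|l u IH] phi.
(* The second copy is resampled before the last update. Once its run is moved inside the step of the
   first copy, it is followed by the feedback, and the two together form a fresh run on the extended
   log. *)
rewrite feed_rcons !mean_bind IH [in RHS]IH; apply: eq_mean => st.
rewrite (eq_mean _ _ (fun s2 => mean_pair_step _ u phi)).
rewrite [in RHS](eq_mean _ _ (fun s2 => mean_pair_step _ u _)) /=.
rewrite exchange_mean [in RHS]exchange_mean; apply: eq_mean => s1.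
rewrite (eq_mean _ _ (fun a => mean_cst _ (feed a _) _)) mean_cst.
by rewrite feed_cat mean_bind.
Qed.

(** After resampling, the cost of the second copy on the last feedback is the cost of a fresh run on
    the extended log minus that on the old log, so the contributions telescope. *)
Lemma cost_pair l : cost f (feed (init pair) l) =
  cost f (feed (init A) l) +
  mean f (feed (init pair) l) (fun st => cost f (feed (init A) (log2 st))).
Proof.
elim/last_ind: l => [|l u IH]; first by rewrite /cost /mean /= addr0.
rewrite !feed_rcons !cost_bind IH mean_bind.
rewrite (eq_mean _ _ (fun st => cost_pair_step st u)) meanD.
rewrite (mean_pair_first l (fun s => cost f (step s u))).
set c := mean f _ (fun st => cost f (feed (init A) (log2 st))).
set m1 := mean f _ _; set m2 := mean f _ _; set m3 := mean f _ _.
suff -> : m3 = c + m2 by ring.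
rewrite /m2 mean_pair_resample /c /m3 -meanD; apply: eq_mean => st.
rewrite mean_pair_step /= exchange_mean.
rewrite -[X in X + _](mean_cst f (step (first st) u)) -meanD; apply: eq_mean => s1.
by rewrite mean_cst feed_cat cost_bind.
Qed.

Variables (k : nat) (tau b : R) (u0 : update V).
Hypothesis thrA : thresholding f k tau A.
Hypothesis costA : amortized_queries f A b.
Hypothesis b_ge0 : 0 <= b.

(** The update [u] changes the ground set by at most one element. The output of the first copy
    changes by at most [q1] elements by Property 2, and by at most [2 * k] because both outputs have
    at most [k] elements. *)
Lemma size_feedback l st q u s1 q1 : supp f (feed (init pair) l) st q ->
  supp f (step (first st) u) s1 q1 ->
  (size (feedback (log1 st) (log2 st) u s1) <= 1 + minn q1 (2 * k))%N.
Proof.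
move=> /supp_pair [E1 [q2 H2] _ E2] H1.
rewrite size_diff_updates E1 E2 ground_of_rcons.
apply: leq_trans (card_diff_setD _ _ _ _) _.
apply: leq_add; first exact: card_diff_update_ground.
have C := thresholding_change u0 thrA H2 H1.
have [_ c1 _] := thresholding_feed u0 thrA H2.
have [|_ c2 _] := @thresholding_feed _ _ f k tau A u0 thrA (rcons l u) s1 (q2 + q1).
  by rewrite feed_rcons; exact: bind_supp H2 H1.
have := subset_leq_card (subsetDl (out s1) (out (first st))).
have := subset_leq_card (subsetDl (out (first st)) (out s1)).
lia.
Qed.

(** Each of the two bounds on the feedback is summed over the run on its own, and the smaller total
    is taken only after averaging. *)
Lemma mean_size_log2 l :
  mean f (feed (init pair) l) (fun st => (size (log2 st))%:R) <=
  (size l)%:R * (1 + Num.min b (2 * k%:R)).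
Proof.
have B1 : mean f (feed (init pair) l) (fun st => (size (log2 st))%:R) <=
    (size l)%:R + cost f (feed (init A) l).
  elim/last_ind: l => [|l u IH]; first by rewrite /mean /cost /= addr0.
  rewrite !feed_rcons mean_bind cost_bind size_rcons -natr1 -mean_pair_first.
  have -> (x y z : R) : x + 1 + (y + z) = (x + y) + (1 + z) by ring.
  apply: le_trans (lerD IH (lexx _)).
  rewrite -[X in X + mean _ _ _](mean_cst f (feed (init pair) l)) -!meanD.
  apply: le_mean => st q H; rewrite mean_pair_step.
  have -> : (size (log2 st))%:R + (1 + cost f (step (first st) u)) =
      expect f (step (first st) u) (fun _ q1 => (size (log2 st))%:R + (1 + q1%:R)).
    by rewrite !expectD !expect_cst.
  apply: le_expect => s1 q1 H1; rewrite /= mean_cst size_cat natrD lerD2l.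
  rewrite addrC natr1 ler_nat; apply: leq_trans (size_feedback H H1) _.
  by rewrite add1n ltnS geq_minl.
have B2 : mean f (feed (init pair) l) (fun st => (size (log2 st))%:R) <=
    (size l)%:R * (1 + 2 * k%:R).
  clear B1; elim/last_ind: l => [|l u IH]; first by rewrite /mean /= mul0r.
  rewrite feed_rcons mean_bind size_rcons -natr1 mulrDl mul1r.
  apply: le_trans (lerD IH (lexx _)).
  rewrite -[X in _ + X](mean_cst f (feed (init pair) l)) -!meanD.
  apply: le_mean => st q H; rewrite mean_pair_step.
  rewrite -[leRHS](mean_cst f (step (first st) u)).
  apply: le_mean => s1 q1 H1; rewrite /= mean_cst size_cat natrD lerD2l.
  rewrite -natrM addrC natr1 ler_nat; apply: leq_trans (size_feedback H H1) _.
  by rewrite add1n ltnS geq_minr.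
have B3 := amortized_feed u0 l costA.
rewrite mulrDr mulr1 minEle; case: ifP => _; last by rewrite mulrDr mulr1 in B2.
by apply: le_trans B1 _; rewrite lerD2l.
Qed.

Lemma cost_pair_le l :
  cost f (feed (init pair) l) <= (size l)%:R * (b * (2 + Num.min b (2 * k%:R))).
Proof.
rewrite cost_pair.
have B1 := amortized_feed u0 l costA.
have B2 : mean f (feed (init pair) l) (fun st => cost f (feed (init A) (log2 st))) <=
   b * mean f (feed (init pair) l) (fun st => (size (log2 st))%:R).
  rewrite -meanZ; apply: le_mean => st q _; rewrite mulrC; exact: amortized_feed.
have B3 := ler_wpM2l b_ge0 (mean_size_log2 l).
lra.
Qed.

End Pair.

(** * Memory of the values queried so far *)

Section Memo.
Variables (R : realType) (V : finType).
Implicit Types (m : {set V} -> R) (X Y W : {set V}).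

Definition remember m X (y : R) : {set V} -> R := fun Y => if Y == X then y else m Y.

Variable f : {set V} -> R.

(** Only a lower bound is asked: sets not yet queried carry the initial value 0, which is correct
    for a nonnegative [f], so maximizing [m] never overrates a set. *)
Definition sound m := forall X, m X <= f X.

Lemma remember_self m X : remember m X (f X) X = f X.
Proof. by rewrite /remember eqxx. Qed.

Lemma remember_known m X Y : m X = f X -> remember m Y (f Y) X = f X.
Proof. by move=> mX; rewrite /remember; case: eqP => [->|]. Qed.

Lemma remember_sound m Y : sound m -> sound (remember m Y (f Y)).
Proof. by move=> sm X; rewrite /remember; case: eqP => [->|]. Qed.

Lemma remember_ge m X Y : sound m -> m X <= remember m Y (f Y) X.
Proof. by move=> sm; rewrite /remember; case: eqP => [->|]. Qed.

Definition best k m W : {set V} :=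
  [arg max_(X > set0 | (X \subset W) && (#|X| <= k)%N) m X]%O.

Lemma best_spec k m W : [/\ best k m W \subset W, (#|best k m W| <= k)%N &
  forall X, X \subset W -> (#|X| <= k)%N -> m X <= m (best k m W)].
Proof.
rewrite /best; case: arg_maxP => [|X /andP[XW cX] maxX]; first by rewrite sub0set cards0.
by split=> // Y YW cY; apply: maxX; rewrite YW.
Qed.

End Memo.

(** * The geometric sequence of thresholds *)

Section Buckets.
Variables (R : realType) (k : nat) (delta : R) (N : nat).
Hypotheses (delta_gt0 : 0 < delta) (k_gt0 : (0 < k)%N) (kN : ln k%:R <= N%:R * delta).

Definition threshold (i : int) : R := expR (i%:~R * delta).

(* The thresholds between y / k and y, roughly: above y, an element of value y
   is negligible; below y / k, the target threshold, which is at least b / k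
   with b >= y, does not occur. *)
Definition buckets (y : R) : seq int :=
  if 0 < y then [seq Num.floor (ln y / delta) - j%:Z | j <- iota 0 N.+1] else [::].

(** For positive [b], the least index whose threshold exceeds [b / k]. Strictness will rule out
    outputs of full size [k]. The value at [b = 0] is arbitrary, and the approximation proof treats
    that case apart. *)
Definition target (b : R) : int := Num.floor (ln (b / k%:R) / delta) + 1.

Lemma buckets_uniq y : uniq (buckets y).
Proof.
rewrite /buckets; case: ifP => // _; rewrite map_inj_uniq ?iota_uniq // => i j.
by move=> /addrI /oppr_inj [].
Qed.

Lemma size_buckets y : (size (buckets y) <= N.+1)%N.
Proof. by rewrite /buckets; case: ifP => // _; rewrite size_map size_iota. Qed.

Lemma target_gt b : 0 < b -> b < k%:R * threshold (target b).
Proof.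
move=> b0; have k0 : 0 < k%:R :> R by rewrite ltr0n.
rewrite mulrC -ltr_pdivrMr // -[ltLHS]lnK ?posrE ?divr_gt0 // ltr_expR.
by rewrite -ltr_pdivrMr //; exact: floorD1_gt.
Qed.

Lemma target_le b : 0 < b -> k%:R * threshold (target b) <= expR delta * b.
Proof.
move=> b0; have k0 : 0 < k%:R :> R by rewrite ltr0n.
rewrite mulrC -ler_pdivlMr // -mulrA -[b / _]lnK ?posrE ?divr_gt0 // -expRD ler_expR.
rewrite /target intrD mulrDl mul1r addrC lerD2l -ler_pdivlMr //.
exact: floor_le.
Qed.

(** Contrapositive: if the target threshold is at most [y], its index is at most
    [floor (ln y / delta)]; since [y <= b] and [ln k <= N * delta], it is also at least that floor
    minus [N]. *)
Lemma notin_buckets_target b y : 0 <= y <= b -> 0 < b ->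
  target b \notin buckets y -> y < threshold (target b).
Proof.
move=> /andP[]; rewrite le_eqVlt => /orP[/eqP<- _ _ _|y0 yb b0].
  exact: expR_gt0.
rewrite /buckets y0 ltNge; apply: contra => le_t.
have k0 : 0 < k%:R :> R by rewrite ltr0n.
set F := Num.floor (ln y / delta); set i := target b in le_t *.
have iF : i <= F.
  rewrite floor_ge_int ler_pdivlMr // -ler_expR lnK //.
have Fi : F - N%:Z <= i.
  have H1 : F%:~R <= ln y / delta := floor_le _.
  have H2 : ln (b / k%:R) / delta < i%:~R := floorD1_gt _.
  have H3 : ln y <= ln b by rewrite ler_ln.
  rewrite ln_div // in H2.
  have H4 : ln k%:R / delta <= N%:R by rewrite ler_pdivrMr.
  have H5 : ln y / delta <= ln b / delta by rewrite ler_pM2r ?invr_gt0.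
  rewrite mulrBl in H2; clearbody i.
  by rewrite -ltzD1 -(ltr_int R) !intrD mulrNz -pmulrn; lra.
apply/mapP; exists `|F - i|%N; first by rewrite mem_iota; lia.
lia.
Qed.

End Buckets.

(** * The algorithm for all thresholds: correctness and cost *)

Section Core.
Variables (R : realType) (V : finType) (A : int -> dynalg R V).
Variables (k : nat) (delta : R) (N : nat).

Let instances := forall i, pair_state (A i).
Let memo := {set V} -> R.

Fixpoint refresh u (s : seq int) (P : instances) (m : memo) : prog R V (instances * memo) :=
  if s is i :: s' then
    bind (pair_step (P i) u) (fun st =>
    Query (out (first st)) (fun y1 => Query (out (second st)) (fun y2 =>
      refresh u s' (dfwith P st)
        (remember (remember m (out (first st)) y1) (out (second st)) y2))))
  else Ret (P, m).

Record core_state := CoreState {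
  insts : instances; known : memo; elements : {set V}; chosen : {set V} }.

Definition core_finish W (a : instances * memo) : prog R V core_state :=
  bind (random_subset R (enum (out (first (a.1 (target k delta (a.2 (best k a.2 W))))))))
    (fun B => Query B (fun y => let m := remember a.2 B y in
      Ret (CoreState a.1 m W (best k m W)))).

(** The singleton is queried on deletions as well, so that an element is deleted from the same
    instances into which it was inserted. Knowing [f set0] ensures that the best known value is at
    least [f set0]. *)
Definition core_step (s : core_state) (u : update V) : prog R V core_state :=
  Query set0 (fun y0 => Query [set u.2] (fun y =>
    bind (refresh u (buckets delta N y) (insts s)
            (remember (remember (known s) set0 y0) [set u.2] y))
         (core_finish (update_ground (elements s) u)))).

Definition core := DynAlg
  (CoreState (fun i => init (pair (A i))) (fun=> 0) set0 set0) core_step chosen.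

Variable f : {set V} -> R.

(** As the indices are distinct, instance [j] is stepped at most once, and the other instances and
    the memory do not influence it. *)
Lemma mean_refresh_component u s P m j (phi : pair_state (A j) -> R) : uniq s ->
  mean f (refresh u s P m) (fun a => phi (a.1 j)) =
  if j \in s then mean f (pair_step (P j) u) phi else phi (P j).
Proof.
elim: s P m => [//|i s IH] P m /= /andP[nis us].
rewrite mean_bind in_cons.
under eq_mean do rewrite /mean /= -/(mean _ _ _) IH //.
case: eqVneq => [ji|ji] /=.
  by subst i; rewrite (negbTE nis); apply: eq_mean => st; rewrite dfwith_in.
under eq_mean do rewrite dfwith_out 1?eq_sym //.
exact: mean_cst.
Qed.

Lemma cost_refresh u s P m : uniq s ->
  cost f (refresh u s P m) = \sum_(i <- s) (cost f (pair_step (P i) u) + 2).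
Proof.
elim: s P m => [|i s IH] P m /=; first by rewrite big_nil.
move=> /andP[nis us]; rewrite cost_bind big_cons -addrA; congr (_ + _).
under eq_mean do rewrite !cost_query IH //.
transitivity (mean f (pair_step (P i) u) (fun=>
    2 + \sum_(j <- s) (cost f (pair_step (P j) u) + 2))); last exact: mean_cst.
apply: eq_mean => st; rewrite addrA; congr (_ + _).
apply: eq_big_seq => j js; rewrite dfwith_out //.
by apply: contraNneq nis => ->.
Qed.

Lemma supp_refresh u s P m a q : uniq s -> supp f (refresh u s P m) a q ->
  [/\ forall j, j \notin s -> a.1 j = P j,
      forall j, j \in s -> [/\ exists q', supp f (pair_step (P j) u) (a.1 j) q',
        a.2 (out (first (a.1 j))) = f (out (first (a.1 j))) &
        a.2 (out (second (a.1 j))) = f (out (second (a.1 j)))],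
      sound f m -> sound f a.2 &
      forall X, m X = f X -> a.2 X = f X].
Proof.
elim: s P m a q => [|i s IH] P m a q /=; first by move=> _ [-> _].
move=> /andP[nis us] H.
have {H} [st [q1 [q2 [H1 [q3 _ [q4 _ H2]] _]]]] := supp_bind H.
have {IH} [I1 I2 I3 I4] := IH _ _ _ _ us H2.
have Ei : a.1 i = st by rewrite I1 // dfwith_in.
split.
- move=> j; rewrite inE negb_or => /andP[ji js]; rewrite I1 // dfwith_out //.
  by rewrite eq_sym.
- move=> j; rewrite inE; case: eqVneq => [-> _|ji /= js].
    rewrite Ei; split; first by exists q1.
      by apply: I4; apply: remember_known; exact: remember_self.
    by apply: I4; exact: remember_self.
  by have := I2 j js; rewrite dfwith_out 1?eq_sym.
- by move=> sm; apply: I3; do 2 apply: remember_sound.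
- by move=> X mX; apply: I4; do 2 apply: remember_known.
Qed.

Lemma cost_core_finish W a : cost f (core_finish W a) = 1.
Proof.
rewrite /core_finish cost_bind cost_random_subset add0r.
rewrite -[RHS](mean_cst f (random_subset R (enum (out (first (a.1 (target k delta (a.2 (best k a.2 W))))))))).
by apply: eq_mean => B; rewrite cost_query /cost /= addr0.
Qed.

Hypotheses (delta_gt0 : 0 < delta) (k_gt0 : (0 < k)%N) (kN : ln k%:R <= N%:R * delta).
Hypotheses (f_ge0 : nonneg f) (f_sub : submodular f).
Hypothesis thrA : forall i, thresholding f k (threshold delta i) (A i).
Variable u0 : update V.

(** The substream reaching instance [i]. It depends on [f] and [l] but on no coin, so each instance
    still faces an oblivious adversary. *)
Definition bucketed i (l : seq (update V)) :=
  [seq u <- l | i \in buckets delta N (f [set u.2])].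

(** The alternative [X = set0] in the last clause covers instances that have received no update:
    their outputs are empty and have not been queried. *)
Definition insts_inv l W (a : instances * memo) :=
  [/\ W = ground_of l, sound f a.2,
      forall e, e \in W -> a.2 [set e] = f [set e],
      forall i, exists q, supp f (feed (init (pair (A i))) (bucketed i l)) (a.1 i) q &
      forall i X, X = out (first (a.1 i)) \/ X = out (second (a.1 i)) ->
        X = set0 \/ a.2 X = f X].

Definition core_inv l (s : core_state) :=
  [/\ insts_inv l (elements s) (insts s, known s),
      chosen s \subset elements s & (#|chosen s| <= k)%N].

Lemma core_inv_init : core_inv [::] (init core).
Proof.
split; rewrite ?sub0set ?cards0 //; split=> //=.
- by move=> e; rewrite inE.
- by move=> i; exists 0%N.
move=> i X.
have [|sub0 _ _] := @thresholding_feed R V f k _ (A i) u0 (thrA i) [::] (init (A i)) 0; first by [].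
by move=> [] ->; left; apply/eqP; rewrite -subset0.
Qed.

Lemma refresh_inv l s u a q : core_inv l s ->
  supp f (refresh u (buckets delta N (f [set u.2])) (insts s)
            (remember (remember (known s) set0 (f set0)) [set u.2] (f [set u.2]))) a q ->
  insts_inv (rcons l u) (update_ground (elements s) u) a /\ a.2 set0 = f set0.
Proof.
move=> [[/= EW sm kn ps ko] _ _] /supp_refresh -/(_ (buckets_uniq _ _ _)) [I1 I2 I3 I4].
have K X : known s X = f X -> a.2 X = f X.
  by move=> kX; apply: I4; do 2 apply: remember_known.
have K0 : a.2 set0 = f set0 by apply: I4; apply: remember_known; exact: remember_self.
split=> //; split.
- by rewrite ground_of_rcons EW.
- by apply: I3; do 2 apply: remember_sound.
- move=> e; case: (eqVneq e u.2) => [-> _|eu]; first by apply: I4; exact: remember_self.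
  rewrite /update_ground; case: ifP => _; rewrite !inE (negbTE eu) /= => eW; exact/K/kn.
- move=> i; rewrite /bucketed filter_rcons; case: ifP => iu.
    have [[q' H'] _ _] := I2 i iu; have [q0 H0] := ps i.
    by exists (q0 + q')%N; rewrite feed_rcons; exact: bind_supp H0 H'.
  by rewrite I1 ?iu //; exact: ps.
- move=> i X; case: (boolP (i \in buckets delta N (f [set u.2]))) => iu.
    by have [_ E1 E2] := I2 i iu; case=> ->; right.
  by rewrite I1 // => /ko [->|/K]; [left|right].
Qed.

Lemma pair_spec i l st q : supp f (feed (init (pair (A i))) l) st q ->
  [/\ out (first st) \subset ground_of l, (#|out (first st)| <= k)%N &
      threshold_property f k (threshold delta i) (ground_of l) (out (first st))] /\
  [/\ out (second st) \subset ground_of l :\: out (first st),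
      (#|out (second st)| <= k)%N &
      threshold_property f k (threshold delta i)
        (ground_of l :\: out (first st)) (out (second st))].
Proof.
move=> /supp_pair [_ [q1 H1] [q2 H2] E].
have [s1 c1 t1] := thresholding_feed u0 (thrA i) H1.
have [s2 c2 t2] := thresholding_feed u0 (thrA i) H2.
by rewrite -E.
Qed.

Lemma ground_of_bucketed i l :
  ground_of (bucketed i l) = [set e in ground_of l | i \in buckets delta N (f [set e])].
Proof. exact: (ground_of_filter (fun e => i \in buckets delta N (f [set e]))). Qed.

Lemma supp_core_finish l W a s q : insts_inv l W a ->
  supp f (core_finish W a) s q ->
  core_inv l s /\
  exists B : {set V}, [/\ B \subset W, (#|B| <= k)%N & s = CoreState a.1 (remember a.2 B (f B)) W
    (best k (remember a.2 B (f B)) W)].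
Proof.
move=> [EW sm kn ps ko] H.
have {H} [B [q1 [q2 [/supp_random_subset [BS _] [q3 _ [-> _]] _]]]] := supp_bind H.
set i := target _ _ _ in BS.
have [q4 /pair_spec [[S1 c1 _] _]] := ps i.
have {}BS : B \subset out (first (a.1 i)).
  by apply: subset_trans BS _; apply/subsetP => x; rewrite inE mem_enum.
have BW : B \subset W.
  apply: subset_trans BS (subset_trans S1 _); rewrite ground_of_bucketed EW.
  by apply/subsetP => x; rewrite inE => /andP[].
have cB : (#|B| <= k)%N := leq_trans (subset_leq_card BS) c1.
split; last by exists B.
have [bW bk _] := best_spec k (remember a.2 B (f B)) W.
split=> //; split=> //=.
- exact: remember_sound.
- by move=> e eW; apply: remember_known; exact: kn.
- by move=> j X /ko [|aX]; [left|right; exact: remember_known].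
Qed.

(** Here [b] is the best value known before sampling and [M] the expected value of the chosen set.
    The inequality [two_thresholds] at the target threshold is bounded term by term by multiples of
    [M]. *)
Lemma core_finish_approx l W a : insts_inv l W a -> a.2 set0 = f set0 ->
  opt f k W <= (6 + 2 * expR delta) * mean f (core_finish W a) (fun s => f (chosen s)).
Proof.
move=> inv K0; have [EW sm kn ps ko] := inv.
set M := mean _ _ _.
have [bW bk bmax] := best_spec k a.2 W.
set b := a.2 (best k a.2 W) in bmax.
have chosen_ge (B : {set V}) : B \subset W -> (#|B| <= k)%N ->
    Num.max b (f B) <= f (best k (remember a.2 B (f B)) W).
  move=> BW cB.
  have [cW ck cmax] := best_spec k (remember a.2 B (f B)) W.
  apply: le_trans (remember_sound B sm _); rewrite ge_max; apply/andP; split.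
    by apply: le_trans (remember_ge _ _ sm) _; exact: cmax.
  by have := cmax B BW cB; rewrite remember_self.
have M_b : b <= M.
  apply: mean_ge => s q /(supp_core_finish inv) [_ [B [BW cB ->]]] /=.
  by have := chosen_ge B BW cB; rewrite ge_max => /andP[].
have r_gt0 : 0 < expR delta := expR_gt0 _.
have b0 : f set0 <= b by rewrite -K0; apply: bmax; rewrite ?sub0set ?cards0.
have b_ge0 : 0 <= b := le_trans (f_ge0 _) b0.
have M_ge0 : 0 <= M := le_trans b_ge0 M_b.
have single e : e \in W -> f [set e] <= b.
  by move=> eW; rewrite -kn //; apply: bmax; rewrite ?sub1set ?cards1.
apply: opt_le => [|O OW cO]; first by apply: mulr_ge0 => //; lra.
(* If [b = 0], every present singleton has value 0, so no set of present elements exceeds [f set0],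
   which is 0 too. *)
have := b_ge0; rewrite le_eqVlt => /orP[/eqP b_eq0|b_gt0].
  apply: le_trans (_ : 0 <= _); last by apply: mulr_ge0 => //; lra.
  rewrite b_eq0; apply: le_trans b0; apply: le_set0_of_marginal => // e eO.
  apply: le_trans (single e (subsetP OW e eO)) _; rewrite -b_eq0; exact: f_ge0.
pose i := target k delta b.
set tau := threshold delta i.
have tau_gt : b < k%:R * tau by exact: target_gt.
have tau_le : k%:R * tau <= expR delta * b by exact: target_le.
have tau_ge0 : 0 <= tau by exact: expR_ge0.
have [q4 Hi] := ps i.
have [[S1 c1 t1] [S2 c2 t2]] := pair_spec Hi.
set T1 := out (first (a.1 i)) in S1 c1 t1 S2 t2.
set T2 := out (second (a.1 i)) in S2 c2 t2.
have GW : ground_of (bucketed i l) \subset W.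
  by rewrite ground_of_bucketed EW; apply/subsetP => x; rewrite inE => /andP[].
have f_le X : X = T1 \/ X = T2 -> f X <= b.
  move=> XT; have [->//|<-] := ko i X XT.
  apply: bmax; case: XT => -> //; first exact: subset_trans S1 GW.
  by apply: subset_trans S2 (subset_trans (subsetDl _ _) GW).
have f1 : f T1 <= b by apply: f_le; left.
have f2 : f T2 <= b by apply: f_le; right.
(* An output of size [k] would have value at least [k * tau], which exceeds [b]. An element sent to
   the instance is covered by Property 1(b); one that is not sent has [f [set e] < tau], which
   bounds its gain by submodularity. *)
have small e (S G : {set V}) : e \in W -> e \notin S ->
    (e \in ground_of (bucketed i l) -> e \in G) -> f S <= b ->
    threshold_property f k tau G S -> marginal f e S <= tau.
  move=> eW eS eG fS [[_ kS]|[_ lt_tau]].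
    by have := lt_le_trans tau_gt (le_trans kS fS); rewrite ltxx.
  case: (boolP (i \in buckets delta N (f [set e]))) => ib.
    by apply/ltW/lt_tau; rewrite inE eS eG // ground_of_bucketed inE -EW eW.
  have lt_e : f [set e] < tau.
    by apply: notin_buckets_target ib; rewrite ?f_ge0 ?single.
  have := submodular_marginal f_sub (sub0set S) eS; rewrite /marginal setU0.
  by have := f_ge0 set0; lra.
have d12 : [disjoint T1 & T2].
  rewrite disjoint_sym disjoints_subset; apply: subset_trans S2 _.
  by apply/subsetP => x; rewrite !inE => /andP[].
have H0 := @two_thresholds R V f O T1 T2 k tau f_ge0 f_sub tau_ge0 cO d12.
have H1 : f O <= f T1 + f T2 + f (O :&: T1) + 2 * k%:R * tau.
  apply: H0 => e; rewrite inE => /andP[e1 eO].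
    by apply: (small e T1 _ _ _ _ _ t1); rewrite // (subsetP OW).
  move=> e2; apply: (small e T2 _ _ _ _ _ t2); rewrite ?(subsetP OW) // => eG.
  by rewrite inE e1.
have H4 := sampling f f_ge0 f_sub (subsetIr O T1).
have M_samp : mean f (random_subset R (enum T1)) f <= M.
  rewrite /M /core_finish mean_bind -/b -/i -/T1; apply: le_mean => B q.
  move=> /supp_random_subset [BS _].
  have {}BS : B \subset T1.
    by apply: subset_trans BS _; apply/subsetP => x; rewrite inE mem_enum.
  have BW : B \subset W := subset_trans BS (subset_trans S1 GW).
  have cB : (#|B| <= k)%N := leq_trans (subset_leq_card BS) c1.
  rewrite /mean /=; apply: le_trans (chosen_ge B BW cB).
  by rewrite le_max lexx orbT.
(* The two outputs contribute [2 * M], the sampled part [4 * M], and the thresholds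
   [2 * expR delta * M]. *)
have : expR delta * b <= expR delta * M by rewrite ler_pM2l.
lra.
Qed.

Lemma supp_core l s q : supp f (feed (init core) l) s q -> core_inv l s.
Proof.
elim/last_ind: l s q => [|l u IH] s q; first by move=> [-> _]; exact: core_inv_init.
rewrite feed_rcons => H; have [s0 [q1 [q2 [/IH inv [q3 _ [q4 _ H2]] _]]]] := supp_bind H.
have [a [q5 [q6 [/(refresh_inv inv) [inv' _] H4 _]]]] := supp_bind H2.
by have [] := supp_core_finish inv' H4.
Qed.

Lemma core_approx l :
  opt f k (ground_of l) <=
  (6 + 2 * expR delta) * mean f (feed (init core) l) (fun s => f (chosen s)).
Proof.
have r_gt0 : 0 < expR delta := expR_gt0 _.
elim/last_ind: l => [|l u _].
  rewrite /mean /=; apply: opt_le => [|X].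
    by apply: mulr_ge0; [lra | exact: f_ge0].
  rewrite subset0 => /eqP-> _; rewrite -[leLHS]mul1r; apply: ler_wpM2r; first exact: f_ge0.
  lra.
rewrite feed_rcons mean_bind -ler_pdivrMl; last by lra.
(* The bound holds for every reachable state after [refresh]; only the coins of the last random
   subset are averaged. *)
apply: mean_ge => s q /supp_core inv.
rewrite /mean /= -/(mean _ _ _) mean_bind.
apply: mean_ge => a q' /(refresh_inv inv) [inv' K0].
rewrite ler_pdivrMl; last by lra.
have [E _ _ _ _] := inv'; rewrite -E.
exact: core_finish_approx inv' K0.
Qed.

Lemma cost_core_step s u : cost f (core_step s u) =
  3 + \sum_(i <- buckets delta N (f [set u.2])) (cost f (pair_step (insts s i) u) + 2).
Proof.
rewrite /core_step !cost_query cost_bind cost_refresh ?buckets_uniq //.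
under eq_mean do rewrite cost_core_finish.
rewrite mean_cst; ring.
Qed.

Lemma mean_core_component l j (phi : pair_state (A j) -> R) :
  mean f (feed (init core) l) (fun s => phi (insts s j)) =
  mean f (feed (init (pair (A j))) (bucketed j l)) phi.
Proof.
elim/last_ind: l phi => [//|l u IH] phi.
rewrite feed_rcons mean_bind /bucketed filter_rcons -/(bucketed j l).
transitivity (mean f (feed (init core) l) (fun s =>
    if j \in buckets delta N (f [set u.2])
    then mean f (pair_step (insts s j) u) phi else phi (insts s j))).
  apply: eq_mean => s; rewrite /mean /= -/(mean _ _ _) mean_bind.
  rewrite -(mean_refresh_component u (insts s)
    (remember (remember (known s) set0 (f set0)) [set u.2] (f [set u.2])) phi (buckets_uniq _ _ _)).
  apply: eq_mean => a; rewrite /core_finish mean_bind.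
  by rewrite /mean /=; exact: expect_cst.
case: ifP => ju; last exact: IH.
by rewrite feed_rcons mean_bind -IH.
Qed.

(** Each update costs three queries, for [set0], the singleton and the random subset, and two for
    the outputs of each of the at most [N.+1] instances it reaches. The rest is the cost of the
    instances, each distributed as a separate run on its substream. *)
Lemma cost_core (I : seq int) l : uniq I ->
  (forall e i, i \in buckets delta N (f [set e]) -> i \in I) ->
  cost f (feed (init core) l) <= (size l)%:R * (3 + 2 * N.+1%:R) +
    \sum_(i <- I) cost f (feed (init (pair (A i))) (bucketed i l)).
Proof.
move=> uI bI; elim/last_ind: l => [|l u IH].
  by rewrite /cost /= mul0r add0r sumr_ge0.
rewrite feed_rcons cost_bind size_rcons -natr1 mulrDl mul1r.
pose bk := buckets delta N (f [set u.2]).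
have -> : \sum_(i <- I) cost f (feed (init (pair (A i))) (bucketed i (rcons l u))) =
    \sum_(i <- I) cost f (feed (init (pair (A i))) (bucketed i l)) +
    \sum_(i <- bk) mean f (feed (init core) l) (fun s => cost f (pair_step (insts s i) u)).
  have -> : \sum_(i <- bk) mean f (feed (init core) l)
        (fun s => cost f (pair_step (insts s i) u)) =
      \sum_(i <- I | i \in bk) mean f (feed (init core) l)
        (fun s => cost f (pair_step (insts s i) u)).
    rewrite -[RHS]big_filter; apply: perm_big; apply: uniq_perm.
    + exact: buckets_uniq.
    + exact: filter_uniq.
    + by move=> i; rewrite mem_filter; apply/idP/andP => [ib|[]//]; split=> //; exact: bI ib.
  rewrite [X in _ = _ + X]big_mkcond -big_split; apply: eq_bigr => i _ /=.
  rewrite /bucketed filter_rcons -/(bucketed i l) -/bk; case: ifP => _; last by rewrite addr0.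
  by rewrite feed_rcons cost_bind -(mean_core_component l (fun st => cost f (pair_step st u))).
have -> : mean f (feed (init core) l) (fun s => cost f (step s u)) =
    3 + (\sum_(i <- bk) mean f (feed (init core) l)
           (fun s => cost f (pair_step (insts s i) u)) + 2 * (size bk)%:R).
  rewrite -mean_sum.
  transitivity (mean f (feed (init core) l) (fun s => 3 +
    (\sum_(i <- bk) cost f (pair_step (insts s i) u) + 2 * (size bk)%:R))).
    apply: eq_mean => s; rewrite cost_core_step big_split /= -/bk.
    by rewrite big_const_seq count_predT iter_addr_0 mulr_natr.
  by rewrite !meanD !mean_cst.
have : (size bk)%:R <= N.+1%:R :> R by rewrite ler_nat size_buckets.
lra.
Qed.

Variable b : R.
Hypothesis costA : forall i, amortized_queries f (A i) b.
Hypothesis b_ge0 : 0 <= b.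

Lemma cost_core_le l : cost f (feed (init core) l) <=
  (size l)%:R * (3 + N.+1%:R * (2 + b * (2 + Num.min b (2 * k%:R)))).
Proof.
(* Since [V] is finite, only finitely many of the integer indices are ever used. *)
pose I := undup (flatten [seq buckets delta N (f [set e]) | e <- enum V]).
have uI : uniq I by exact: undup_uniq.
have bI e i : i \in buckets delta N (f [set e]) -> i \in I.
  move=> ib; rewrite mem_undup; apply/flatten_mapP; exists e => //.
  by rewrite mem_enum.
apply: le_trans (cost_core l uI bI) _.
set K := b * _.
have K_ge0 : 0 <= K.
  apply: mulr_ge0 => //; apply: addr_ge0 => //.
  by rewrite le_min b_ge0 mulr_ge0.
have H1 : \sum_(i <- I) cost f (feed (init (pair (A i))) (bucketed i l)) <=
    (\sum_(i <- I) size (bucketed i l))%N%:R * K.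
  rewrite natr_sum mulr_suml; apply: ler_sum => i _.
  exact: cost_pair_le u0 (thrA i) (costA i) b_ge0 _.
(* Double counting: each update enters at most [N.+1] substreams. *)
have H2 : (\sum_(i <- I) size (bucketed i l) <= size l * N.+1)%N.
  elim/last_ind: (l) => [|l' u IH]; first by rewrite big1.
  rewrite size_rcons mulSn addnC.
  have -> : (\sum_(i <- I) size (bucketed i (rcons l' u)) =
     \sum_(i <- I) size (bucketed i l') + \sum_(i <- I) (i \in buckets delta N (f [set u.2])))%N.
    rewrite -big_split; apply: eq_bigr => i _ /=.
    by rewrite /bucketed filter_rcons; case: ifP => _; rewrite ?addn0 // size_rcons addn1.
  apply: leq_add => //; rewrite -big_mkcond /= sum1_count -size_filter.
  apply: leq_trans (size_buckets delta N (f [set u.2])).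
  apply: uniq_leq_size; first exact: filter_uniq.
  by move=> i; rewrite mem_filter => /andP[].
have H3 : (\sum_(i <- I) size (bucketed i l))%N%:R * K <= (size l)%:R * (N.+1%:R * K).
  by rewrite mulrA -natrM; apply: ler_wpM2r => //; rewrite ler_nat.
lra.
Qed.

End Core.

(** * The algorithm that always reports the empty set *)

Section Idle.
Variables (R : realType) (V : finType) (f : {set V} -> R) (k : nat).
Hypothesis f_ge0 : nonneg f.

Lemma opt_ge0 W : 0 <= opt f k W.
Proof. exact: bigmax_ge_id. Qed.

Definition idle : dynalg R V := DynAlg tt (fun s _ => Ret s) (fun _ => set0).

Lemma run_idle Xi t : run idle Xi t = Ret tt.
Proof. by elim: t => //= t ->. Qed.

Lemma idle_spec alpha b : (forall W, opt f k W <= f set0) -> 1 <= alpha -> 0 <= b ->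
  [/\ maintains f k idle, approximates f k alpha idle & amortized_queries f idle b].
Proof.
move=> opt0 a1 b0; split=> Xi t; rewrite run_idle /=.
- by rewrite sub0set cards0.
- rewrite ler_pdivrMr ?(lt_le_trans ltr01) //; apply: le_trans (opt0 _) _.
  by rewrite -[leLHS]mulr1; apply: ler_wpM2l.
- exact: mulr_ge0.
Qed.

End Idle.

(** * Running an algorithm only with a given probability *)

Section Lottery.
Variables (R : realType) (V : finType) (D : dynalg R V) (p : R).
Hypotheses (p_ge0 : 0 <= p) (p_le1 : p <= 1).

(* None: no update yet; Some None: the coin told the algorithm to stay idle. *)
Definition lottery_step (s : option (option (state D))) (u : update V) :
    prog R V (option (option (state D))) :=
  match s with
  | None => Flip (Itv01 p_ge0 p_le1) (fun c =>
      if c then bind (step (init D) u) (fun s' => Ret (Some (Some s')))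
      else Ret (Some None))
  | Some None => Ret (Some None)
  | Some (Some s) => bind (step s u) (fun s' => Ret (Some (Some s')))
  end.

Definition lottery := DynAlg None lottery_step (fun s =>
  if s is Some (Some s') then out s' else set0).

Lemma feed_lottery_some s l : @feed R V lottery (Some (Some s)) l =
  bind (feed s l) (fun s' => Ret (Some (Some s'))).
Proof.
elim: l s => [//|u l IH] s /=; rewrite !bindA; congr (bind _ _).
by apply: funext => s' /=; exact: IH.
Qed.

Lemma feed_lottery_none l : @feed R V lottery (Some None) l = Ret (Some None).
Proof. by elim: l. Qed.

Lemma feed_lottery_cons u l : feed (init lottery) (u :: l) =
  Flip (Itv01 p_ge0 p_le1) (fun c =>
    if c then bind (feed (init D) (u :: l)) (fun s' => Ret (Some (Some s')))
    else Ret (Some None)).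
Proof.
rewrite /=; congr (Flip _ _); apply: funext => -[]; last exact: feed_lottery_none.
rewrite !bindA; congr (bind _ _); apply: funext => s /=.
exact: feed_lottery_some.
Qed.

Lemma run_lottery Xi t : run lottery Xi t.+1 =
  Flip (Itv01 p_ge0 p_le1) (fun c =>
    if c then bind (run D Xi t.+1) (fun s' => Ret (Some (Some s')))
    else Ret (Some None)).
Proof. by rewrite !run_feed; exact: feed_lottery_cons. Qed.

Lemma expect_run_lottery f Xi t h : expect f (run lottery Xi t.+1) h =
  p * expect f (run D Xi t.+1) (fun s q => h (Some (Some s)) q) +
  (1 - p) * h (Some None) 0%N.
Proof.
rewrite run_lottery [LHS]/= -/(run D Xi t.+1) expect_bind; congr (_ * _ + _).
by apply: eq_expect => s q; rewrite /= addn0.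
Qed.

Variables (f : {set V} -> R) (k : nat) (alpha b : R).
Hypotheses (f_ge0 : nonneg f) (p_gt0 : 0 < p) (alpha_ge1 : 1 <= alpha).

(** A single coin decides for the whole run, so the cost scales by [p] and the expected value by at
    least [p]. At time 0 no coin has been tossed, and [alpha / p >= 1] suffices. *)
Lemma lottery_spec :
  [/\ maintains f k D, approximates f k alpha D & amortized_queries f D b] ->
  [/\ maintains f k lottery, approximates f k (alpha / p) lottery &
      amortized_queries f lottery (p * b)].
Proof.
have a_gt0 : 0 < alpha := lt_le_trans ltr01 alpha_ge1.
case=> mD aD qD; split=> Xi [|t].
- by rewrite /= ?sub0set ?cards0.
- rewrite run_lottery; apply/alwaysP => s q [[_ H]|[_ [-> _]]] /=; last first.
    by rewrite sub0set cards0.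
  have [s' [q1 [q2 [H1 [-> _] _]]]] := supp_bind H.
  by have /alwaysP/(_ _ _ H1) := mD Xi t.+1.
- rewrite /= ground0 ler_pdivrMr ?divr_gt0 //; apply: opt_le => [|X].
    by rewrite mulr_ge0 // ltW // divr_gt0.
  rewrite subset0 => /eqP-> _; rewrite -[leLHS]mulr1; apply: ler_wpM2l => //.
  by rewrite ler_pdivlMr // mul1r; apply: le_trans p_le1 _.
- rewrite expect_run_lottery invf_div mulrCA.
  apply: le_trans (_ : p * expect f (run D Xi t.+1) (fun s _ => f (out s)) <= _).
    by apply: ler_wpM2l => //; exact: aD.
  by rewrite lerDl mulr_ge0 // subr_ge0.
- by rewrite /= mul0r.
- rewrite expect_run_lottery mulr0 addr0 mulrCA.
  by apply: ler_wpM2l => //; exact: qD.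
Qed.

End Lottery.

(* Inserting an element v of positive marginal value tau into the empty ground
   set forces a tau-thresholding algorithm to change its output, hence to query. *)
Lemma thresholding_queries_ge1 (R : realType) (V : finType) (f : {set V} -> R)
    (k : nat) (v : V) (A : dynalg R V) (b : R) :
  (0 < k)%N -> thresholding f k (marginal f v set0) A -> amortized_queries f A b ->
  1 <= b.
Proof.
move=> k0 thr am; pose u := ins v.
have := amortized_feed u [:: u] am; rewrite /= mul1r; apply: le_trans.
rewrite bind_ret -(expect_cst f (step (init A) u) 1); apply: le_expect => s q H.
rewrite ler1n.
have H0 : supp f (feed (init A) [::]) (init A) 0 by [].
have [sub0 _ _] := thresholding_feed u thr H0.
have := thresholding_change u thr H0 H.
rewrite (_ : out (init A) = set0) ?setD0; last by apply/eqP; rewrite -subset0.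
apply: leq_trans; rewrite addn_gt0; apply/orP; left.
have [|_ _ th] := @thresholding_feed _ _ f k _ A u thr [:: u] s q.
  by rewrite /= bind_ret.
rewrite lt0n; apply/negP => /eqP c0.
case: th => [[ck _]|[_ lt_m]]; first by rewrite -ck c0 in k0.
move/eqP: c0; rewrite cards_eq0 => /eqP s0.
have vg : v \in ground_of [:: u] by rewrite /ground_of /= /update_ground !inE eqxx.
by have := lt_m v; rewrite s0 setD0 ltxx => /(_ vg).
Qed.

(** * Choice of parameters and constants *)

Section Reduction.
Variables (R : realType) (C : R) (V : finType) (F : ({set V} -> R) -> Prop).
Variables (k : nat) (G : R).
Hypotheses (C_gt0 : 0 < C) (F_sub : forall f, F f -> nonneg f /\ submodular f).
Hypothesis G_ge0 : 0 <= G.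
Hypothesis thr : forall tau : R, 0 < tau -> exists A : dynalg R V, forall f, F f ->
  thresholding f k tau A /\ amortized_queries f A (C * G).

Let rate (eps : R) := Num.min k%:R G * G * eps^-1 * logk R k.

Lemma logk_ge1 : 1 <= logk R k.
Proof. by rewrite /logk le_max lexx. Qed.

Lemma rate_ge0 (eps : R) : 0 < eps -> 0 <= rate eps.
Proof.
move=> e0; rewrite /rate; apply: mulr_ge0; last exact: le_trans ler01 logk_ge1.
apply: mulr_ge0; last by rewrite invr_ge0 ltW.
by apply: mulr_ge0 => //; rewrite le_min ler0n.
Qed.

(** From [expR (- x) >= 1 - x], and [(1 + 2 * x) * (1 - x) >= 1] on this range. *)
Lemma expR_le_1D2 (x : R) : 0 <= x <= 2^-1 -> expR x <= 1 + 2 * x.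
Proof.
move=> /andP[x0 x1]; have H := expR_ge1Dx (- x).
have y0 := expR_gt0 x.
have E : expR x * expR (- x) = 1 by rewrite -expRD subrr expR0.
have H1 : expR x * (1 - x) <= 1 by rewrite -[leRHS]E ler_pM2l.
rewrite -(@ler_pM2r _ (1 - x)); last by lra.
apply: le_trans H1 _; nra.
Qed.

Lemma small_accuracy (eps : R) : (0 < k)%N -> 1 <= C * G -> 0 < eps <= 1 ->
  exists B : dynalg R V, forall f, F f ->
    [/\ maintains f k B, approximates f k (8 + eps) B &
        amortized_queries f B (18 * C * (5 * C + 6) * rate eps)].
Proof.
move=> k0 CG /andP[e0 e1].
(* With [expR delta <= 1 + 2 * delta], the factor [6 + 2 * expR delta] is at most
   [8 + 4 * delta = 8 + eps]. *)
pose delta := eps / 4.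
have d0 : 0 < delta by rewrite divr_gt0.
have k1 : 1 <= k%:R :> R by rewrite ler1n.
have lnk0 : 0 <= ln (k%:R : R) by exact: ln_ge0.
have L1 := logk_ge1.
have lnk : ln (k%:R : R) <= logk R k by rewrite /logk le_max lexx orbT.
(* One more than the truncation, so that [N * delta >= ln k]; then [N.+1] is at most
   [4 * ln k / eps + 2]. *)
pose N := (Num.truncn (ln (k%:R : R) / delta)).+1.
have /andP[N1 N2] : (Num.truncn (ln (k%:R : R) / delta))%:R <= ln (k%:R : R) / delta < N%:R.
  by apply: truncn_itv; rewrite divr_ge0 // ltW.
have kN : ln (k%:R : R) <= N%:R * delta by rewrite -ler_pdivrMr // ltW.
have tau0 i : 0 < threshold delta i by exact: expR_gt0.
(* Choice of one algorithm per threshold, made before [f] is introduced, so that the result is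
   uniform over [F]. *)
pose A i := projT1 (cid (thr (tau0 i))).
have HA i f : F f -> thresholding f k (threshold delta i) (A i) /\
    amortized_queries f (A i) (C * G) by exact: projT2 (cid (thr (tau0 i))) f.
exists (core A k delta N) => f Ff.
have [f_ge0 f_sub] := F_sub Ff.
have thrA i : thresholding f k (threshold delta i) (A i) by have [] := HA i f Ff.
have amA i : amortized_queries f (A i) (C * G) by have [] := HA i f Ff.
split=> Xi t; rewrite run_feed.
- apply/alwaysP => s q /(supp_core f_ge0 thrA (Xi 0%N)) [[E _ _ _ _] cW ck].
  by rewrite ground_mkseq -E.
- have := core_approx d0 k0 kN f_ge0 f_sub thrA (Xi 0%N) (mkseq Xi t).
  rewrite -ground_mkseq ler_pdivrMr; last by lra.
  set M := mean _ _ _ => H; rewrite -/(mean _ _ _) -/M mulrC; apply: le_trans H _.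
  apply: ler_wpM2r; first by apply: mean_ge => s q _; exact: f_ge0.
  have : expR delta <= 1 + 2 * delta by apply: expR_le_1D2; rewrite /delta; lra.
  by rewrite /delta; lra.
- have CG0 : 0 <= C * G by lra.
  have := cost_core_le N thrA (Xi 0%N) amA CG0 (mkseq Xi t).
  rewrite size_mkseq -/(cost _ _) => H; apply: le_trans H _.
  apply: ler_wpM2l => //.
  pose a := Num.min k%:R G.
  have a0 : 0 <= a by rewrite le_min G_ge0 ler0n.
  have Ck : 0 <= C * k%:R by apply: mulr_ge0; rewrite ?ler0n ?ltW.
  have a1 : 1 <= (C + 1) * a.
    by rewrite /a minEle mulrDl mul1r; case: ifP => _; have := G_ge0; lra.
  have a2 : Num.min (C * G) (2 * k%:R) <= (C + 2) * a.
    rewrite ge_min /a [Num.min k%:R G]minEle mulrDl; have := G_ge0.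
    by case: ifP => _ ?; apply/orP; [right|left]; lra.
  set K := C * G * _.
  (* Both 2s, the one added to [K] and the one inside it, are absorbed by [1 <= (C + 1) * a], the
     outer one also by [1 <= C * G]. The coefficients [3 * C + 4] and [2 * C + 2] add up to
     [5 * C + 6]. *)
  have K_le : 2 + K <= C * (5 * C + 6) * (a * G).
    have : K <= C * G * ((3 * C + 4) * a) by apply: ler_wpM2l => //; lra.
    have : 1 * 1 <= (C * G) * ((C + 1) * a) by apply: ler_pM.
    nra.
  have K2 : 2 <= 2 + K.
    have : 0 <= Num.min (C * G) (2 * k%:R) by rewrite le_min CG0 mulr_ge0.
    by rewrite lerDl => m0; apply: mulr_ge0 => //; lra.
  have N3 : N.+1%:R <= 6 * (eps^-1 * logk R k).
    have ie : 1 <= eps^-1 by rewrite invf_ge1.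
    have E : ln (k%:R : R) / delta = 4 * (eps^-1 * ln (k%:R : R)).
      by rewrite /delta; field; rewrite gt_eqF.
    have : eps^-1 * ln (k%:R : R) <= eps^-1 * logk R k by rewrite ler_pM2l ?invr_gt0.
    have : 1 <= eps^-1 * logk R k by nra.
    by rewrite -natr1 -[N%:R]natr1; lra.
  have N4 : 1 <= N.+1%:R :> R by rewrite ler1n.
  have : N.+1%:R * (2 + K) <= (6 * (eps^-1 * logk R k)) * (C * (5 * C + 6) * (a * G)).
    by apply: ler_pM => //; lra.
  (* As the product is at least 2, adding 3 at most triples it, whence 18 as 3 times 6. *)
  have : 1 * 2 <= N.+1%:R * (2 + K) by apply: ler_pM.
  rewrite /rate -/a; lra.
Qed.

Lemma any_accuracy (eps : R) : 0 < eps ->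
  exists B : dynalg R V, forall f, F f ->
    [/\ maintains f k B, approximates f k (8 + eps) B &
        amortized_queries f B (162 * C * (5 * C + 6) * rate eps)].
Proof.
move=> e0.
have C5 : 0 <= C * (5 * C + 6) by have C0 := C_gt0; apply: mulr_ge0; lra.
have r0 := rate_ge0 e0.
have r1 : 0 <= C * (5 * C + 6) * rate eps by apply: mulr_ge0.
have [k0|k0] := posnP k.
  exists (idle R V) => f Ff; have [f_ge0 _] := F_sub Ff.
  apply: idle_spec => //; [|lra|lra] => W; apply: opt_le => // X _.
  by rewrite k0 leqn0 cards_eq0 => /eqP->.
case: (lerP 1 (C * G)) => CG; last first.
  (* When [C * G < 1], no [f] in [F] has an element of positive gain over [set0]: taking that gain
     as the threshold would force at least one query per update. The empty set is then optimal. *)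
  exists (idle R V) => f Ff; have [f_ge0 f_sub] := F_sub Ff.
  apply: idle_spec => //; [|lra|lra] => W; apply: opt_le => // X _ _.
  apply: le_set0_of_marginal => // e _; rewrite leNgt; apply/negP => lt_e.
  have m0 : 0 < marginal f e set0 by rewrite /marginal setU0 subr_gt0.
  have [A /(_ f Ff) [tA aA]] := thr m0.
  by have := thresholding_queries_ge1 k0 tA aA; lra.
have [e1|e1] := lerP eps 1.
  have [|B HB] := @small_accuracy eps k0 CG; first by rewrite e0.
  exists B => f /HB [mB aB qB]; split=> // Xi T; apply: le_trans (qB Xi T) _.
  by apply: ler_wpM2l => //; lra.
(* For [eps > 1] the query bound must keep falling like [1 / eps]. Running the algorithm for
   accuracy 1 with probability [9 / (8 + eps)] turns the guarantee 9 into [8 + eps]; as this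
   probability is at most [9 / eps], the constant 18 grows to 162. *)
have [|B HB] := @small_accuracy 1 k0 CG; first by rewrite ltr01 lexx.
pose p : R := 9 / (8 + eps).
have p_gt0 : 0 < p by rewrite divr_gt0 //; lra.
have p_le1 : p <= 1 by rewrite ler_pdivrMr; lra.
exists (lottery B (ltW p_gt0) p_le1) => f Ff; have [f_ge0 _] := F_sub Ff.
have a1 : 1 <= 8 + 1 :> R by lra.
have [mL aL qL] := lottery_spec (ltW p_gt0) p_le1 f_ge0 p_gt0 a1 (HB f Ff).
have E : (8 + 1) / p = 8 + eps by rewrite /p; field; rewrite !gt_eqF //; lra.
rewrite E in aL; split=> // Xi T; apply: le_trans (qL Xi T) _.
apply: ler_wpM2l => //.
have p_le : p <= 9 * eps^-1.
  by rewrite /p ler_pM2l // lef_pV2 ?posrE //; lra.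
have R1 : rate eps = rate 1 * eps^-1 by rewrite /rate invr1 mulr1; ring.
have : p * (C * (5 * C + 6) * rate 1) <= 9 * eps^-1 * (C * (5 * C + 6) * rate 1).
  by apply: ler_wpM2r => //; apply: mulr_ge0 => //; exact: rate_ge0.
rewrite R1; lra.
Qed.

End Reduction.

Theorem theorem1 (R : realType) (C : R) (hC : 0 < C) :
  exists2 C' : R, 0 < C' &
    forall (V : finType) (F : ({set V} -> R) -> Prop) (k : nat)
           (g : nat -> nat -> R),
      (forall f, F f -> nonneg f /\ submodular f) ->
      (forall n m : nat, 0 <= g n m) ->
      (forall tau : R, 0 < tau ->
         exists A : dynalg R V, forall f, F f ->
           thresholding f k tau A /\
           amortized_queries f A (C * g #|V| k)) ->
      forall eps : R, 0 < eps ->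
        (exists B : dynalg R V, forall f, F f ->
           [/\ maintains f k B,
               approximates f k (8 + eps) B &
               amortized_queries f B
                 (C' * (k%:R + Num.min k%:R (g #|V| k) * g #|V| k
                               * eps^-1 * logk R k))]) /\
        (exists B : dynalg R V, forall f, F f ->
           [/\ maintains f k B,
               approximates f k (10 + eps) B &
               amortized_queries f B
                 (C' * (Num.min k%:R (g #|V| k) * g #|V| k
                        * eps^-1 * logk R k))]).
Proof.
have C'_gt0 : 0 < 162 * C * (5 * C + 6) by apply: mulr_gt0; lra.
exists (162 * C * (5 * C + 6)) => // V F k g F_sub g_ge0 thr eps e0.
(* The same algorithm serves both parts: its query bound is below the first one as [k%:R >= 0], and
   a guarantee [8 + eps] is also a guarantee [10 + eps]. *)
have [B HB] := any_accuracy hC F_sub (g_ge0 _ _) thr e0.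
split; exists B => f /HB [mB aB qB]; split=> //.
- move=> Xi T; apply: le_trans (qB Xi T) _; apply: ler_wpM2l => //.
  by rewrite ler_pM2l // lerDr.
- move=> Xi t; apply: le_trans (aB Xi t); apply: ler_wpM2l; first exact: opt_ge0.
  by rewrite lef_pV2 ?posrE; lra.
Qed.
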